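(* Let $t\ge 1$ be an integer. Then $\chi_p(P_{2t}\Diamond_2 C_5)\le 4$ if $t=1$, $\chi_p(P_{2t}\Diamond_2 C_5)\le 5$ if $2\le t\le 4$, and $\chi_p(P_{2t}\Diamond_2 C_5)\le 6$ if $t\ge 5$. Moreover, equality holds for $t\in\{1,2,3,4\}$.
   Context: A packing $k$-coloring of a graph $H$ is a map $c:V(H)\to\{1,\ldots,k\}$ such that any two distinct vertices $u,v$ with $c(u)=c(v)=i$ satisfy $d_H(u,v)\ge i+1$. The packing chromatic number $\chi_p(H)$ is the least such $k$. $P_m$ denotes the path $v_1\cdots v_m$ and $C_n$ the cycle on $n$ vertices. Path-aligned product: for positive integers $\ell\mid m$ and a connected vertex-transitive graph $G$ containing $P_\ell$ as a subgraph, $P_m\Diamond_\ell G$ is formed from the path $P_m=v_1\cdots v_m$ and $m/\ell$ pairwise disjoint copies of $G$, where for each $1\le i\le m/\ell$ the consecutive path vertices $v_{(i-1)\ell+1},\ldots,v_{i\ell}$ are identified, in order, with the vertices of a path $P_\ell$ (i.e. $\ell$ consecutive cycle vertices when $G$ is a cycle) in the $i$-th copy of $G$. *)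

(* Defs.v *)
From mathcomp Require Import all_boot.

Set Implicit Arguments.
Unset Strict Implicit.
Unset Printing Implicit Defensive.

Record sgraph := SGraph {
  vertex :> finType;
  adj : rel vertex;
  adj_sym : symmetric adj;
  adj_irrefl : irreflexive adj }.

(* H occurs in G as a (not necessarily induced) subgraph. *)
Record embedding (H G : sgraph) := Embedding {
  emb :> H -> G;
  emb_inj : injective emb;
  emb_adj : forall x y : H, adj x y -> adj (emb x) (emb y) }.

Section PathGraph.
Variable m : nat.

Definition path_adj : rel 'I_m := fun i j => (i.+1 == j) || (j.+1 == i).

Lemma path_adj_sym : symmetric path_adj.
Proof. by move=> i j; rewrite /path_adj orbC. Qed.

Lemma path_adj_irrefl : irreflexive path_adj.
Proof. by move=> i; rewrite /path_adj orbb gtn_eqF. Qed.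

Definition path_graph : sgraph := SGraph path_adj_sym path_adj_irrefl.
End PathGraph.

Section CycleGraph.
Variable n : nat.

(* ordS is the cyclic successor i.+1 %% n; this is the cycle C_n for 3 <= n,
   the test i != j being redundant unless n = 1. *)
Definition cycle_adj : rel 'I_n :=
  fun i j => (i != j) && ((ordS i == j) || (ordS j == i)).

Lemma cycle_adj_sym : symmetric cycle_adj.
Proof. by move=> i j; rewrite /cycle_adj eq_sym orbC. Qed.

Lemma cycle_adj_irrefl : irreflexive cycle_adj.
Proof. by move=> i; rewrite /cycle_adj eqxx. Qed.

Definition cycle_graph : sgraph := SGraph cycle_adj_sym cycle_adj_irrefl.
End CycleGraph.

Section Packing.
Variable G : sgraph.

Definition walk (n : nat) (x y : G) : bool :=
  [exists p : n.-tuple G, path (@adj G) x p && (last x p == y)].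

(* The length of a shortest walk from x to y, which is less than #|G| as soon
   as x and y are connected. For disconnected x and y the distance is infinite
   and the value of dist (here #|G|) is irrelevant. *)
Definition dist (x y : G) : nat := find (fun n => walk n x y) (iota 0 #|G|).

(* The colours are 1, ..., k: the element i of 'I_k stands for colour i.+1. *)
Definition packing_coloring (k : nat) (c : {ffun G -> 'I_k}) : bool :=
  [forall x, forall y,
     [&& x != y, c x == c y & connect (@adj G) x y]
       ==> ((c x).+1 + 1 <= dist x y)].

Definition packing_colorable (k : nat) : bool :=
  [exists c : {ffun G -> 'I_k}, packing_coloring c].

Lemma packing_colorable_ex : exists k, packing_colorable k.
Proof.
exists #|G|; apply/existsP; exists [ffun x => enum_rank x].
apply/forallP=> x; apply/forallP=> y; apply/implyP=> /and3P[nxy].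
by rewrite !ffunE (inj_eq enum_rank_inj) (negPf nxy).
Qed.

Definition packing_chromatic_number : nat := ex_minn packing_colorable_ex.
End Packing.

(* The path-aligned product of P_m and G, where m = t * l. The i-th copy of G
   is {i} x G, and p i is the chosen path P_l in it. As l divides m, every
   vertex of P_m is identified with a vertex of some copy of G, so the vertex
   set is 'I_t * G; the j-th vertex of P_m (counting from 0) is identified with
   vertex number j %% l of the path p i in the copy i = j %/ l. *)
Section PathAlignedProduct.
Variables (t l : nat) (G : sgraph) (p : 'I_t -> embedding (path_graph l) G).

Lemma aligned_l_gt0 (j : 'I_(t * l)) : 0 < l.
Proof. by have := leq_ltn_trans (leq0n j) (ltn_ord j); rewrite muln_gt0 => /andP[]. Qed.

Lemma copy_of_subproof (j : 'I_(t * l)) : j %/ l < t.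
Proof. by rewrite ltn_divLR ?ltn_ord // (aligned_l_gt0 j). Qed.

Lemma pos_of_subproof (j : 'I_(t * l)) : j %% l < l.
Proof. by rewrite ltn_mod (aligned_l_gt0 j). Qed.

Definition copy_of (j : 'I_(t * l)) : 'I_t := Ordinal (copy_of_subproof j).
Definition pos_of (j : 'I_(t * l)) : 'I_l := Ordinal (pos_of_subproof j).

Definition path_vertex (j : path_graph (t * l)) : 'I_t * G :=
  (copy_of j, p (copy_of j) (pos_of j)).

Lemma path_vertex_inj : injective path_vertex.
Proof.
move=> j k [Ejk Epos]; apply: val_inj => /=.
have Ec : copy_of j = copy_of k by apply: val_inj.
move: Epos; rewrite Ec => /emb_inj /(congr1 val) /= Er.
by rewrite (divn_eq j l) (divn_eq k l) Ejk Er.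
Qed.

Definition aligned_adj : rel ('I_t * G) := fun x y =>
  (x.1 == y.1) && adj x.2 y.2
  || [exists j : path_graph (t * l), exists k : path_graph (t * l),
       [&& adj j k, path_vertex j == x & path_vertex k == y]].

Lemma aligned_adj_sym : symmetric aligned_adj.
Proof.
move=> x y; rewrite /aligned_adj eq_sym adj_sym; congr orb.
by apply/existsP/existsP=> -[j /existsP[k /and3P[jk jx ky]]];
  exists k; apply/existsP; exists j; rewrite adj_sym jk jx ky.
Qed.

Lemma aligned_adj_irrefl : irreflexive aligned_adj.
Proof.
move=> x; rewrite /aligned_adj adj_irrefl andbF /=.
apply/existsP=> -[j /existsP[k /and3P[jk /eqP jx /eqP kx]]].
have ejk := path_vertex_inj (etrans jx (esym kx)).
by move: jk; rewrite ejk path_adj_irrefl.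
Qed.

Definition path_aligned_product : sgraph :=
  SGraph aligned_adj_sym aligned_adj_irrefl.
End PathAlignedProduct.

(* Main.v *)
(** Label the vertices of the i-th 5-cycle 0, 1, 2, 3, 4 around the cycle,
    starting with the two path vertices in order.  Whatever the orientation of
    the chosen edges, the product becomes the graph in which consecutive cycles
    are joined by the bridge from (i, 1) to (i + 1, 0), and the distance between
    vertices of different cycles is the length of the route through all the
    intermediate bridges.  The upper bounds come from an explicit colouring of
    four cycles with 5 colours and one of period two cycles with 6 colours; the
    latter needs a check for cycles at most three apart only, since all other
    pairs are at distance at least 7.  The lower bounds follow by exhausting the
    colourings of the first cycle with 3 colours and of the first two cycles
    with 4 colours. *)

Require Import Defs.
From mathcomp Require Import all_boot zify.

Set Implicit Arguments.
Unset Strict Implicit.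
Unset Printing Implicit Defensive.

Section Walks.
Variable G : sgraph.
Implicit Types x y z : G.

Lemma walk0 x : walk 0 x x.
Proof. by apply/existsP; exists [tuple]; rewrite /= eqxx. Qed.

Lemma walkS n x y z : walk n x y -> adj y z -> walk n.+1 x z.
Proof.
case/existsP=> q /andP[xq /eqP qy] yz; apply/existsP; exists [tuple of rcons q z].
by rewrite /= rcons_path xq qy yz last_rcons eqxx.
Qed.

Lemma walk_connect n x y : walk n x y -> connect (@adj G) x y.
Proof. by case/existsP=> q /andP[xq /eqP <-]; apply/connectP; exists q. Qed.

Lemma dist_le_walk n x y : walk n x y -> dist x y <= n.
Proof.
move=> xyn; rewrite /dist leqNgt; apply/negP=> lt_n.
have n_lt : n < #|G|.
  by apply: leq_trans lt_n _; rewrite -[X in _ <= X](size_iota 0) find_size.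
by have /negP[] := negbT (before_find 0 lt_n); rewrite nth_iota ?add0n.
Qed.

Lemma walk_dist x y : connect (@adj G) x y -> walk (dist x y) x y.
Proof.
case/connectP=> q xq ->; case/shortenP: xq => {}q xq uq _.
have q_lt : size q < #|G|.
  by have := max_card [in x :: q]; rewrite (card_uniqP uq).
have Hhas : has (fun n => walk n x (last x q)) (iota 0 #|G|).
  apply/hasP; exists (size q); first by rewrite mem_iota.
  by apply/existsP; exists (in_tuple q); rewrite /= xq eqxx.
have := nth_find 0 Hhas; rewrite nth_iota ?add0n //.
by move: Hhas; rewrite has_find size_iota.
Qed.

Lemma lipschitz_le_dist (f : G -> nat) x y :
    (forall y z, adj y z -> f z <= (f y).+1) -> f x = 0 ->
  connect (@adj G) x y -> f y <= dist x y.
Proof.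
move=> fS fx /walk_dist; move: (dist x y) => n /existsP[q /andP[xq /eqP yq]].
rewrite -(size_tuple q) -[X in _ <= X]addn0 -fx -{}yq.
elim: (tval q) x xq {fx} => //= z r IHr x /andP[/fS xz /IHr zr].
by apply: leq_trans zr _; rewrite addSnnS leq_add2l.
Qed.

Lemma chi_le k : packing_colorable G k -> packing_chromatic_number G <= k.
Proof. by rewrite /packing_chromatic_number; case: ex_minnP => m _; apply. Qed.

Lemma chi_gt k : (forall j, j <= k -> ~~ packing_colorable G j) ->
  k < packing_chromatic_number G.
Proof.
move=> Hk; rewrite /packing_chromatic_number; case: ex_minnP => m Cm _.
by rewrite ltnNge; apply/negP=> /Hk; rewrite Cm.
Qed.

End Walks.

(** * The model graph on pairs (cycle, label) *)

Definition cadj (r s : nat) : bool := (r.+1 %% 5 == s) || (s.+1 %% 5 == r).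

Definition cdist (r s : nat) : nat := minn (r - s + (s - r)) (5 - (r - s + (s - r))).

Definition medge (u v : nat * nat) : bool :=
  [|| (u.1 == v.1) && cadj u.2 v.2,
      [&& u.1.+1 == v.1, u.2 == 1 & v.2 == 0]
    | [&& v.1.+1 == u.1, v.2 == 1 & u.2 == 0]].

Definition mdist (u v : nat * nat) : nat :=
  if u.1 == v.1 then cdist u.2 v.2
  else if u.1 < v.1 then cdist 1 u.2 + (v.1 - u.1).*2.-1 + cdist 0 v.2
  else cdist 1 v.2 + (u.1 - v.1).*2.-1 + cdist 0 u.2.

Lemma cdistC r s : cdist r s = cdist s r.
Proof. by rewrite /cdist addnC. Qed.

Lemma cdistnn r : cdist r r = 0.
Proof. by rewrite /cdist subnn min0n. Qed.

Lemma mdistnn u : mdist u u = 0.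
Proof. by rewrite /mdist eqxx cdistnn. Qed.

Lemma mdistC u v : mdist u v = mdist v u.
Proof. by rewrite /mdist eq_sym cdistC; case: ltngtP. Qed.

Lemma mdist_shift k i j r s : mdist (k + i, r) (k + j, s) = mdist (i, r) (j, s).
Proof. by rewrite /mdist /= eqn_add2l ltn_add2l !subnDl. Qed.

Lemma all_iota_lt n (P : pred nat) : all P (iota 0 n) -> forall i, i < n -> P i.
Proof. by move=> /allP HP i lt_i; apply: HP; rewrite mem_iota. Qed.

Lemma cdist_lipschitz q r s : q < 5 -> r < 5 -> s < 5 -> cadj r s ->
  cdist q s <= (cdist q r).+1.
Proof.
move=> q5 r5 s5; apply/implyP; move: s s5; apply: all_iota_lt.
move: r r5; apply: all_iota_lt; move: q q5; apply: all_iota_lt.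
by vm_compute.
Qed.

Lemma mdist_lipschitz u v w : u.2 < 5 -> v.2 < 5 -> w.2 < 5 -> medge v w ->
  mdist u w <= (mdist u v).+1.
Proof.
case: u v w => [i q] [j r] [k s] /= q5 r5 s5; rewrite /medge /mdist /=.
have c01 : cdist 0 1 = 1 by [].
have c10 : cdist 1 0 = 1 by [].
case/or3P=> [/andP[/eqP<- rs]|/and3P[/eqP<- /eqP-> /eqP->]|/and3P[/eqP<- /eqP-> /eqP->]].
- have := cdist_lipschitz q5 r5 s5 rs.
  have := @cdist_lipschitz 0 r s isT r5 s5 rs.
  have := @cdist_lipschitz 1 r s isT r5 s5 rs.
  by case: ltngtP => _; lia.
- have := @cdist_lipschitz q 1 0 q5 isT isT isT.
  have := cdistnn 0; have := cdistnn 1; rewrite ![cdist q _]cdistC.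
  by case: (ltngtP i j) => ?; case: (ltngtP i j.+1) => ?; lia.
have := @cdist_lipschitz q 0 1 q5 isT isT isT.
have := cdistnn 0; have := cdistnn 1; rewrite ![cdist q _]cdistC.
by case: (ltngtP i k) => ?; case: (ltngtP i k.+1) => ?; lia.
Qed.

(** * Labelling the cycles *)

(* The position of v on the 5-cycle, counted from a in the direction of b. *)
Definition lab (a b v : nat) : nat :=
  if b == a.+1 %% 5 then (v + 5 - a) %% 5 else (a + 5 - v) %% 5.

Lemma lab_lt5 a b v : lab a b v < 5.
Proof. by rewrite /lab; case: ifP => _; rewrite ltn_mod. Qed.

Lemma lab_spec a b : a < 5 -> b < 5 -> cadj a b ->
  [/\ lab a b a = 0, lab a b b = 1,
      {in gtn 5 &, injective (lab a b)},
      {in gtn 5 &, forall v w, cadj (lab a b v) (lab a b w) = cadj v w}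
    & forall r, r < 5 -> exists2 v, v < 5 & lab a b v = r].
Proof.
move=> a5 b5 ab.
pose I := iota 0 5.
have /implyP/(_ ab)/and4P[/eqP-> /eqP-> Hvw Hr] : cadj a b ==>
  [&& lab a b a == 0, lab a b b == 1,
      all (fun v => all (fun w => ((lab a b v == lab a b w) ==> (v == w)) &&
         (cadj (lab a b v) (lab a b w) == cadj v w)) I) I
    & all (fun r => has (fun v => lab a b v == r) I) I].
  move: b b5 {ab}; apply: all_iota_lt; move: a a5; apply: all_iota_lt.
  by vm_compute.
have {}Hvw v w : v < 5 -> w < 5 -> ((lab a b v == lab a b w) ==> (v == w)) &&
         (cadj (lab a b v) (lab a b w) == cadj v w).
  by move=> v5 w5; have := all_iota_lt (all_iota_lt Hvw v5) w5.
split=> // [v w v5 w5 /eqP e | v w v5 w5 | r r5].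
- by have /andP[/implyP/(_ e)/eqP] := Hvw v w v5 w5.
- by have /andP[_ /eqP] := Hvw v w v5 w5.
have /hasP[v] := all_iota_lt Hr r5.
by rewrite mem_iota => /andP[_ v5] /eqP e; exists v.
Qed.

Lemma cycle5_adjE (v w : cycle_graph 5) : adj v w = cadj v w.
Proof.
rewrite /adj /= /cycle_adj /cadj -!val_eqE /=.
case: eqP => //= ->; case: w => w /=.
by do 5?[case: w => [|w] //].
Qed.

Section Product.
Variables (t : nat) (p : 'I_t -> embedding (path_graph 2) (cycle_graph 5)).
Let G := path_aligned_product p.

Definition label (i : 'I_t) (v : 'I_5) : nat :=
  lab (p i (inord 0 : 'I_2)) (p i (inord 1 : 'I_2)) v.

Definition code (x : G) : nat * nat := (val x.1, label x.1 x.2).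

Lemma label_spec i :
  [/\ label i (p i (inord 0 : 'I_2)) = 0, label i (p i (inord 1 : 'I_2)) = 1,
      injective (label i),
      forall v w, cadj (label i v) (label i w) = cadj v w
    & forall r, r < 5 -> exists v, label i v = r].
Proof.
have ab : adj (p i (inord 0 : 'I_2)) (p i (inord 1 : 'I_2)).
  by apply: emb_adj; rewrite /= /path_adj !inordK.
rewrite cycle5_adjE in ab.
have [la lb linj ladj lsurj] := lab_spec (ltn_ord _) (ltn_ord _) ab.
split=> // [v w e | v w | r /lsurj[v v5 e]].
- by apply/val_inj/linj => //; apply: ltn_ord.
- by apply: ladj; apply: ltn_ord.
by exists (Ordinal v5).
Qed.

Lemma code_lt x : (code x).1 < t /\ (code x).2 < 5.
Proof. by split; [apply: ltn_ord | apply: lab_lt5]. Qed.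

Lemma code_inj : injective code.
Proof.
case=> [i v] [j w] [/val_inj <- e]; congr pair.
by have [_ _ linj _ _] := label_spec i; apply: linj.
Qed.

Lemma code_surj u : u.1 < t -> u.2 < 5 -> exists x, code x = u.
Proof.
case: u => i r /= lt_i r5; have [_ _ _ _ /(_ r r5)[v e]] := label_spec (Ordinal lt_i).
by exists (Ordinal lt_i, v); rewrite /code /= e.
Qed.

Lemma code_path_vertex j : code (path_vertex p j) = (j %/ 2, j %% 2).
Proof.
congr pair; rewrite /path_vertex /= /pos_of.
have [la lb _ _ _] := label_spec (copy_of j).
have : pos_of j = inord (j %% 2) by apply: val_inj; rewrite /= inordK ?ltn_mod.
rewrite /pos_of => ->; by rewrite modn2; case: odd.
Qed.

Lemma path_bridge (x y : G) : (code x).1.+1 = (code y).1 ->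
  (code x).2 = 1 -> (code y).2 = 0 -> adj x y.
Proof.
have [+ _] := code_lt y.
case ex: (code x) => [i r]; case ey: (code y) => [j s] /= lt_jt eij er es.
have lt_i : i * 2 + 1 < t * 2 by lia.
have lt_j : j * 2 < t * 2 by lia.
apply/orP; right; apply/existsP; exists (Ordinal lt_i); apply/existsP; exists (Ordinal lt_j).
rewrite -!(inj_eq (@code_inj)) !code_path_vertex ex ey er es.
apply/and3P; split; first by rewrite /= /path_adj /=; lia.
  by rewrite xpair_eqE /=; lia.
by rewrite xpair_eqE /=; lia.
Qed.

Lemma adj_code (x y : G) : adj x y = medge (code x) (code y).
Proof.
apply/orP/idP; last first.
  case/or3P=> [/andP[e1 e2]|/and3P[/eqP ? /eqP ? /eqP ?]|/and3P[/eqP ? /eqP ? /eqP ?]].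
  - left; case: x y e1 e2 => [i v] [j w] /= /eqP/val_inj <- ; rewrite eqxx /=.
    by have [_ _ _ -> _] := label_spec i; rewrite -cycle5_adjE.
  - exact/orP/path_bridge.
  by apply/orP; have := @path_bridge y x; rewrite adj_sym; apply.
case=> [/andP[]|/existsP[j /existsP[k /and3P[jk /eqP<- /eqP<-]]]].
  case: x y => [i v] [j w] /= /eqP <- vw; rewrite /medge /= eqxx /=.
  by have [_ _ _ -> _] := label_spec i; rewrite -cycle5_adjE /= vw.
rewrite !code_path_vertex /medge /cadj /=.
by move: jk; rewrite /adj /= /path_adj; lia.
Qed.

Lemma mdist_le_dist x y : connect (@adj G) x y -> mdist (code x) (code y) <= dist x y.
Proof.
apply: (lipschitz_le_dist (f := fun y => mdist (code x) (code y))); last exact: mdistnn.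
move=> {}y z; rewrite adj_code; apply: mdist_lipschitz; exact: lab_lt5.
Qed.

(* The model colours start at 0, hence [c u + 2] for colour [c u + 1]. *)
Lemma model_colorable k (c : nat * nat -> nat) : (forall u, u.1 < t -> u.2 < 5 -> c u < k) ->
    (forall u v, u.1 < t -> v.1 < t -> u.2 < 5 -> v.2 < 5 -> u != v -> c u = c v ->
       c u + 2 <= mdist u v) ->
  packing_colorable G k.
Proof.
move=> ck cP.
have {}ck x : c (code x) < k by apply: ck; case: (code_lt x).
apply/existsP; exists [ffun x => Ordinal (ck x)].
apply/forallP=> x; apply/forallP=> y; apply/implyP; rewrite !ffunE -val_eqE /=.
case/and3P=> nxy /eqP e xy; apply: leq_trans (mdist_le_dist xy).
rewrite addSnnS; apply: cP; rewrite ?(inj_eq code_inj) //.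
all: by case: (code_lt x); case: (code_lt y).
Qed.

End Product.

(** * Exhaustive search for colourings of the first cycles *)

Definition mverts (m : nat) : seq (nat * nat) := [seq (i, r) | i <- iota 0 m, r <- iota 0 5].

Lemma mem_mverts m (u : nat * nat) : (u \in mverts m) = (u.1 < m) && (u.2 < 5).
Proof.
apply/allpairsP/andP=> [[[i r] [im r5 ->]]|[u1 u2]].
  by move: im r5; rewrite !mem_iota.
by exists u; rewrite !mem_iota; split=> //; case: u {u1 u2}.
Qed.

Definition reach (m n : nat) (u : nat * nat) : seq (nat * nat) :=
  iter n (fun s => [seq w <- mverts m | has (medge^~ w) s]) [:: u].

Fixpoint colorings (k : nat) (vs : seq (nat * nat)) : seq (seq ((nat * nat) * nat)) :=
  if vs is v :: vs' then
    [seq (v, a) :: s | s <- colorings k vs',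
       a <- [seq a <- iota 0 k | all (fun q => (q.2 == a) ==> (a + 2 <= mdist q.1 v)) s]]
  else [:: [::]].

Lemma colorings_complete k vs (c : nat * nat -> nat) : uniq vs ->
    (forall u, c u < k) ->
    {in vs &, forall u v, u != v -> c u = c v -> c v + 2 <= mdist u v} ->
  [seq (v, c v) | v <- vs] \in colorings k vs.
Proof.
move=> + ck; elim: vs => //= v vs IHvs /andP[v_vs /IHvs{}IHvs] cP.
apply/allpairsPdep; exists [seq (w, c w) | w <- vs], (c v); split=> //.
  by apply: IHvs => u w uvs wvs; apply: cP; rewrite inE ?uvs ?wvs orbT.
rewrite mem_filter mem_iota add0n ck !andbT; apply/allP=> _ /mapP[w wvs ->] /=.
apply/implyP=> /eqP e; apply: cP; rewrite ?inE ?eqxx ?wvs ?orbT //.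
by apply: contraNneq v_vs => <-.
Qed.

Section LowerBound.
Variables (t : nat) (p : 'I_t -> embedding (path_graph 2) (cycle_graph 5)).
Let G := path_aligned_product p.

Lemma reach_walk m n (x y : G) : m <= t -> code y \in reach m n (code x) -> walk n x y.
Proof.
move=> mt; elim: n y => [|n IHn] y.
  by rewrite inE => /eqP/code_inj ->; apply: walk0.
rewrite mem_filter => /andP[/hasP[v vn vy] _].
have [v1 v2] : v.1 < t /\ v.2 < 5.
  case: n vn {IHn} => [|n]; first by rewrite inE => /eqP ->; apply: code_lt.
  by rewrite mem_filter mem_mverts => /and3P[_ v1 v2]; split=> //; apply: leq_trans mt.
have [z ez] := code_surj p v1 v2; move: vn vy; rewrite -ez => /IHn xz zy.
by apply: walkS xz _; rewrite adj_code.
Qed.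

Lemma model_not_colorable m k : 0 < m <= t ->
    all (fun u => all (fun v => v \in reach m (mdist u v) u) (mverts m)) (mverts m) ->
    uniq (mverts m) -> nilp (colorings k (mverts m)) ->
  forall j, j <= k -> ~~ packing_colorable G j.
Proof.
case/andP=> m0 mt /allP Hreach um /nilP Hk j jk; apply/existsP=> -[c /forallP cP].
have [x0 _] := @code_surj _ p (0, 0) (leq_trans m0 mt) isT.
pose dec u := odflt x0 [pick x | code x == u].
have decK u : u \in mverts m -> code (dec u) = u.
  rewrite mem_mverts /dec => /andP[u1 u2].
  have [x ex] := code_surj p (leq_trans u1 mt) u2.
  by case: pickP => [y /eqP //|/(_ x)]; rewrite ex eqxx.
suff: [seq (v, nat_of_ord (c (dec v))) | v <- mverts m] \in colorings k (mverts m) by rewrite Hk.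
apply: (colorings_complete (c := fun v => c (dec v))) => // [u|u v um' vm nuv e].
  exact: leq_trans (ltn_ord _) jk.
have uv : walk (mdist u v) (dec u) (dec v).
  by apply: (reach_walk mt); rewrite !decK //; apply: (allP (Hreach u um')).
apply: leq_trans (dist_le_walk uv); rewrite -e -addSnnS.
move/forallP: (cP (dec u)) => /(_ (dec v)) /implyP.
apply; rewrite -(inj_eq (@code_inj _ p)) !decK // nuv /=.
by rewrite -val_eqE /= e eqxx (walk_connect uv).
Qed.

Lemma chi_ge4 : 0 < t -> 3 < packing_chromatic_number G.
Proof. by move=> t0; apply/chi_gt/(@model_not_colorable 1) => //; vm_compute. Qed.

Lemma chi_ge5 : 1 < t -> 4 < packing_chromatic_number G.
Proof. by move=> t1; apply/chi_gt/(@model_not_colorable 2) => //; vm_compute. Qed.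

End LowerBound.

(** * Explicit colourings *)

Definition color4 (u : nat * nat) : nat :=
  nth 0 (nth [::] [:: [:: 0; 1; 0; 2; 3]; [:: 4; 0; 1; 0; 2];
                      [:: 3; 0; 2; 0; 1]; [:: 1; 0; 2; 4; 0]] u.1) u.2.

Definition color_per2 (u : nat * nat) : nat :=
  nth 0 (if odd u.1 then [:: 0; 2; 0; 1; 4] else [:: 0; 1; 0; 5; 3]) u.2.

Lemma color4_packing (u v : nat * nat) : u \in mverts 4 -> v \in mverts 4 -> u != v ->
  color4 u = color4 v -> color4 u + 2 <= mdist u v.
Proof.
move=> u4 v4 nuv /eqP e; apply: (implyP (implyP _ nuv) e); move: v v4 {nuv e}; apply/allP.
by move: u u4; apply/allP; vm_compute.
Qed.

Lemma color_per2_packing (u v : nat * nat) : u.2 < 5 -> v.2 < 5 -> u != v ->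
  color_per2 u = color_per2 v -> color_per2 u + 2 <= mdist u v.
Proof.
wlog le_uv : u v / u.1 <= v.1.
  move=> IH u5 v5 nuv e; case: (leqP u.1 v.1) => [|/ltnW] le_uv; first exact: IH.
  by rewrite e mdistC; apply: IH; rewrite // eq_sym.
case: u v le_uv => [i r] [j s] /= le_ij r5 s5.
have [far | near] := leqP (i + 4) j.
  have c6 : color_per2 (i, r) < 6.
    rewrite /color_per2 /=; case: odd; move: r r5; apply: all_iota_lt; by vm_compute.
  move=> _ _; apply: (@leq_trans 7); first lia.
  by rewrite /mdist /=; case: (ltngtP i j); lia.
have [d d4 ->] : exists2 d, d < 4 & j = i + d by exists (j - i); lia.
have -> : i = i./2.*2 + odd i by rewrite addnC odd_double_half.
move: (odd i) (i./2) => b h {i le_ij near j}.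
rewrite -addnA mdist_shift xpair_eqE eqn_add2l -xpair_eqE.
rewrite /color_per2 /= !oddD odd_double /= oddb => nrs /eqP e.
apply: (implyP (implyP _ nrs) e); move: s s5 {nrs e}; apply: all_iota_lt.
move: r r5; apply: all_iota_lt; move: d d4; apply: all_iota_lt.
by case: b; vm_compute.
Qed.

Section UpperBound.
Variables (t : nat) (p : 'I_t -> embedding (path_graph 2) (cycle_graph 5)).
Let G := path_aligned_product p.

Lemma chi_le_color4 k : t <= 4 -> all (fun u => color4 u < k) (mverts t) ->
  packing_chromatic_number G <= k.
Proof.
move=> t4 /allP ck; apply/chi_le/(@model_colorable _ _ _ color4) => [u u1 u2|u v u1 v1 u2 v2].
  by apply: ck; rewrite mem_mverts u1 u2.
by apply: color4_packing; rewrite mem_mverts ?u2 ?v2 andbT (leq_trans _ t4).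
Qed.

Lemma chi_le6 : packing_chromatic_number G <= 6.
Proof.
apply/chi_le/(@model_colorable _ _ _ color_per2) => [[i r] _ /= r5|u v _ _].
  by rewrite /color_per2 /=; case: odd; move: r r5; apply: all_iota_lt; vm_compute.
exact: color_per2_packing.
Qed.

End UpperBound.

Theorem theorem3 (t : nat) (t_gt0 : 1 <= t)
    (p : 'I_t -> embedding (path_graph 2) (cycle_graph 5)) :
  let chi := packing_chromatic_number (path_aligned_product p) in
  [/\ t = 1 -> chi <= 4,
      2 <= t <= 4 -> chi <= 5,
      5 <= t -> chi <= 6
    & (t = 1 -> chi = 4) /\ (2 <= t <= 4 -> chi = 5)].
Proof.
move=> chi.
have le4 : t = 1 -> chi <= 4 by move=> t1; apply: chi_le_color4; rewrite t1.
have le5 : 2 <= t <= 4 -> chi <= 5.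
  case/andP=> _ t4; apply: chi_le_color4 => //.
  by move: t t4 {t_gt0 p chi le4}; apply: (@all_iota_lt 5); vm_compute.
split=> // [_|]; first exact: chi_le6.
split=> [t1 | t24]; apply/eqP; rewrite eqn_leq ?le4 ?le5 //=.
  exact: chi_ge4.
by apply: chi_ge5; case/andP: t24.
Qed.
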